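(* Let $G=(V,w,m)$ be a locally finite measured weighted graph and let $K>0$. Suppose $\operatorname{Deg}_{\max}\le1$, $m(V)=\sum_{x\in V}m(x)=1$, and $\kappa(x,y)\ge K$ for all $x\neq y\in V$. Let $f\in\ell^1(V,m)$ satisfy $\langle f\rangle=0$ and $\|\nabla f\|_\infty\le1$. Then for every $r>0$, $$m(\{x\in V: f(x)>r\})\le e^{-Kr^2}.$$
   Context: A measured weighted graph $G=(V,w,m)$: countable $V$, symmetric $w:V\times V\to[0,\infty)$ vanishing on the diagonal, $m:V\to(0,\infty)$; $x\sim y$ iff $w(x,y)>0$; locally finite means each vertex has finitely many neighbours. $q(x,y):=w(x,y)/m(x)$, $\Delta f(x):=\sum_y q(x,y)(f(y)-f(x))$, $\operatorname{Deg}_{\max}:=\sup_x\sum_y q(x,y)$. $d$ is the combinatorial graph distance. For $x\ne y$, $\nabla_{xy}f:=(f(x)-f(y))/d(x,y)$, $\|\nabla f\|_\infty:=\sup_{x\sim y}\nabla_{xy}f$, and the Ollivier curvature is $\kappa(x,y):=\inf\{\nabla_{xy}\Delta f: \nabla_{yx}f=1,\ \|\nabla f\|_\infty=1\}$. $\ell^1(V,m)=\{g:V\to\mathbb{R}:\sum_x m(x)|g(x)|<\infty\}$, $\langle g\rangle:=\sum_x m(x)g(x)$, and $m(A):=\sum_{x\in A}m(x)$.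
   Formalization: The graph is additionally assumed connected, so that d is finite; without this the claim fails, e.g. for two isolated vertices of mass 1/2, where the curvature condition is vacuous and f = ±a has mean zero but violates the bound for large r < a. *)

(* Defs.v *)
From HB Require Import structures.
From mathcomp Require Import all_boot all_order all_algebra.
From mathcomp Require Import all_classical all_reals all_analysis.
Set Implicit Arguments. Unset Strict Implicit. Unset Printing Implicit Defensive.
Import Order.TTheory GRing.Theory Num.Theory.
Local Open Scope classical_set_scope.
Local Open Scope ring_scope.

Section Graph.
Variables (R : realType) (V : countType) (w : V -> V -> R) (m : V -> R).

Definition is_mwgraph : Prop :=
  [/\ (forall x y, 0 <= w x y), (forall x y, w x y = w y x),
      (forall x, w x x = 0) & (forall x, 0 < m x)].

Definition adj (x y : V) : Prop := 0 < w x y.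

Definition locally_finite : Prop := forall x, finite_set [set y | adj x y].

Inductive walk : nat -> V -> V -> Prop :=
  | walk0 x : walk 0 x x
  | walkS n x y z : walk n x y -> adj y z -> walk n.+1 x z.

Definition graph_connected : Prop := forall x y, exists n, walk n x y.

Definition dist (x y : V) : R := inf [set (n%:R : R) | n in [set n | walk n x y]].

Definition q (x y : V) : R := w x y / m x.

(* Laplacian: sum over neighbours (q(x,y) = 0 for non-neighbours) *)
Definition Lap (f : V -> R) (x : V) : R :=
  (\sum_(y \in [set y | adj x y]) q x y * (f y - f x))%R.

Definition Deg (x : V) : R := (\sum_(y \in [set y | adj x y]) q x y)%R.

Definition Deg_max : \bar R := ereal_sup [set (Deg x)%:E | x in setT].

Definition nabla (x y : V) (f : V -> R) : R := (f x - f y) / dist x y.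

Definition grad_norm (f : V -> R) : \bar R :=
  ereal_sup [set (nabla p.1 p.2 f)%:E | p in [set p : V * V | adj p.1 p.2]].

Definition kappa (x y : V) : \bar R :=
  ereal_inf [set (nabla x y (Lap f))%:E |
             f in [set f : V -> R | nabla y x f = 1 /\ grad_norm f = 1%E]].

Definition meas (A : set V) : \bar R := \esum_(x in A) (m x)%:E.

Definition ell1 (f : V -> R) : Prop := summable setT (fun x => (m x * f x)%:E).

(* <f> = sum_x m(x) f(x), the sum of an absolutely summable family *)
Definition mean (f : V -> R) : \bar R :=
  (\esum_(x in setT) ((fun x => (m x * f x)%:E)^\+ x)
   - \esum_(x in setT) ((fun x => (m x * f x)%:E)^\- x))%E.

End Graph.

(* Main.v *)
Require Import Defs.
From HB Require Import structures.
From mathcomp Require Import all_boot all_order all_algebra.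
From mathcomp Require Import all_classical all_reals all_analysis.
From mathcomp Require Import ring lra.
Import Order.TTheory GRing.Theory Num.Theory.
Import numFieldNormedType.Exports.
Local Open Scope classical_set_scope.
Local Open Scope ring_scope.

(** Testing the curvature bound against a distance function gives the
    Bonnet-Myers bound [dist <= 2 / K], so by local finiteness [V] is finite.
    For [0 < eps <= 1/2] the operator [P = 1 + eps * Lap] preserves means and
    shrinks Lipschitz constants by the factor [rho = 1 - eps * K].  If [f] is
    [L]-Lipschitz, convexity of the exponential, summation by parts and
    [(e^a - e^b) (a - b) <= (e^a + e^b) / 2 * (a - b)^2] give
    [(1 - eps * L^2 / 2) <e^f> <= <e^(P f)>].  Iterating, [P^n f -> <f> = 0] while
    the losses sum to a geometric series in [rho^2]; letting [eps] tend to [0]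
    yields [<e^f> <= e^(L^2 / (4 K))], and Markov's inequality for
    [e^(2 K r f)] concludes. *)

(** * A trapezoid inequality for the exponential *)

Section expR_trapezoid.
Variable R : realType.
Implicit Types a b t : R.

Lemma expRB1_le t : 0 <= t -> expR t - 1 <= (expR t + 1) * t / 2.
Proof.
rewrite le_eqVlt => /predU1P[<-|t0]; first by rewrite expR0 mulr0 mul0r subrr.
(* Twice the gap between the two sides is [phi t - phi 0]; the derivative of [phi] is nonnegative
   because [1 - u <= expR (- u)]. *)
pose phi (u : R) : R := (u - 2) * expR u + u.
have dphi (u : R) : is_derive u 1 phi ((u - 1) * expR u + 1).
  rewrite /phi; apply: is_derive_eq.
  by rewrite /GRing.scale /= ; ring.
have cphi : {within `[0, t], continuous phi}.
  apply: continuous_subspaceT => u; apply: differentiable_continuous.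
  by apply/derivable1_diffP; case: (dphi u).
have [u ut] := @MVT_segment R phi _ 0 t (ltW t0) (fun u _ => dphi u) cphi.
rewrite /phi expR0 => phiE.
have u0 : 0 <= u by move: ut; rewrite in_itv /= => /andP[].
have : 0 <= (u - 1) * expR u + 1.
  have := expR_ge1Dx (- u); rewrite -(ler_pM2r (expR_gt0 u)) expRN mulVf.
    by lra.
  by rewrite gt_eqF ?expR_gt0.
by move=> /mulr_ge0/(_ (ltW t0)); rewrite subr0 in phiE; lra.
Qed.

(** Both sides are symmetric in [a] and [b]; for [t = a - b >= 0] this is the trapezoid inequality
    multiplied by [expR b * t]. *)
Lemma expR_secant_le a b :
  (expR a - expR b) * (a - b) <= (expR a + expR b) / 2 * (a - b) ^+ 2.
Proof.
wlog ba : a b / b <= a.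
  by move=> H; have [/H//|/ltW/H] := leP b a; lra.
have -> : a = b + (a - b) by ring.
have : 0 <= a - b by rewrite subr_ge0.
move: (a - b) => t t0; rewrite expRD (_ : b + t - b = t); last by ring.
have := expRB1_le _ t0; rewrite -subr_ge0 => h.
have := mulr_ge0 (mulr_ge0 (expR_ge0 b) t0) h.
by lra.
Qed.

End expR_trapezoid.

(** * Laplacian, graph distance and Lipschitz functions *)

Section graph.
Variables (R : realType) (V : countType) (w : V -> V -> R) (m : V -> R).
Implicit Types (f g h : V -> R) (x y z : V).

(** One-sided, since adjacency is symmetric; the real-valued form of [grad_norm w f <= L]. *)
Definition lipschitz (L : R) f := forall x y, adj w x y -> f y - f x <= L.

Hypothesis Gwm : is_mwgraph w m.
Hypothesis LFw : locally_finite w.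
Hypothesis conn : graph_connected w.
Hypothesis DegM : (Deg_max w m <= 1)%E.

Let w_ge0 x y : 0 <= w x y. Proof. by case: Gwm. Qed.
Let w_sym x y : w x y = w y x. Proof. by case: Gwm. Qed.
Let w_irr x : w x x = 0. Proof. by case: Gwm. Qed.
Let m_gt0 x : 0 < m x. Proof. by case: Gwm. Qed.
Let q_ge0 x y : 0 <= q w m x y.
Proof. by rewrite divr_ge0 // ltW. Qed.

Lemma adjC x y : adj w x y -> adj w y x.
Proof. by rewrite /adj w_sym. Qed.

Lemma adj_neq x y : adj w x y -> x <> y.
Proof. by move=> + xy; rewrite /adj xy w_irr ltxx. Qed.

Lemma Deg_le1 x : Deg w m x <= 1.
Proof.
by rewrite -lee_fin; apply: le_trans DegM; apply: ereal_sup_ubound; exists x.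
Qed.

Lemma LapD f h x : Lap w m (fun y => f y + h y) x = Lap w m f x + Lap w m h x.
Proof.
rewrite /Lap !fsbig_finite //= -big_split /=.
by apply: eq_bigr => y _; ring.
Qed.

Lemma LapZ (c : R) f x : Lap w m (fun y => c * f y) x = c * Lap w m f x.
Proof.
rewrite /Lap !fsbig_finite //= mulr_sumr.
by apply: eq_bigr => y _; ring.
Qed.

(** The weights [q w m x y] sum to at most 1 over [y], and [0 <= c] covers the missing mass. *)
Lemma Lap_le f x (c : R) : 0 <= c ->
  (forall y, adj w x y -> f y - f x <= c) -> Lap w m f x <= c.
Proof.
move=> c0 fc; apply: (@le_trans _ _ (c * Deg w m x)); last first.
  by rewrite ler_piMr // Deg_le1.
rewrite /Lap /Deg !fsbig_finite //= mulr_sumr big_seq [leRHS]big_seq.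
apply: ler_sum => y; rewrite in_fset_set // inE /= => xy.
by rewrite mulrC ler_wpM2r // fc.
Qed.

Lemma Lap_ge f x (c : R) : 0 <= c ->
  (forall y, adj w x y -> f x - f y <= c) -> - c <= Lap w m f x.
Proof.
move=> c0 fc; rewrite lerNl -mulN1r -LapZ; apply: Lap_le => // y /fc.
by lra.
Qed.

Lemma lipschitz_walk (L : R) f n x y : lipschitz L f -> walk w n x y ->
  f y - f x <= n%:R * L.
Proof.
move=> fL; elim => [z|k a b c _ IH /fL bc]; first by rewrite subrr mul0r.
by rewrite -natr1; lra.
Qed.

(** Connectedness makes the set of walk lengths nonempty, so its least element attains the
    infimum. *)
Lemma distP x y : exists n, [/\ walk w n x y, dist w x y = n%:R
  & forall k, walk w k x y -> dist w x y <= k%:R].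
Proof.
have [k0 k0P] := conn x y.
have ex : exists n, `[< walk w n x y >] by exists k0; apply/asboolP.
case: (ex_minnP ex) => n /asboolP nP nmin.
have dE : dist w x y = n%:R.
  apply/eqP; rewrite eq_le; apply/andP; split.
    apply: ge_inf; last by exists n.
    by exists 0 => _ [k _ <-]; rewrite ler0n.
  apply: lb_le_inf; first by exists n%:R, n.
  by move=> _ [k /asboolP /nmin nk <-]; rewrite ler_nat.
exists n; split => // k /asboolP /nmin nk.
by rewrite dE ler_nat.
Qed.

Lemma dist_ge0 x y : 0 <= dist w x y.
Proof. by have [n [_ -> _]] := distP x y. Qed.

Lemma distxx x : dist w x x = 0.
Proof.
have [n [_ _ /(_ 0)]] := distP x x => /(_ (walk0 _ _)) d0.
by apply/eqP; rewrite eq_le d0 dist_ge0.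
Qed.

Lemma dist_gt0 x y : x <> y -> 0 < dist w x y.
Proof.
have [[|n] [xy -> _]] := distP x y; last by rewrite ltr0n.
by inversion xy.
Qed.

Lemma dist_adj x y : adj w x y -> dist w x y = 1.
Proof.
move=> xy; have [n [nP dE]] := distP x y => /(_ 1).
move=> /(_ (walkS (walk0 _ _) xy)) d1; apply/eqP; rewrite eq_le d1 /=.
have := dist_gt0 _ _ (adj_neq _ _ xy).
by rewrite dE ltr0n ler1n.
Qed.

Lemma dist_lipschitz x : lipschitz 1 (dist w x).
Proof.
move=> y z yz; have [n [nP -> _]] := distP x y.
have [_ [_ _ /(_ n.+1)]] := distP x z.
by move=> /(_ (walkS nP yz)); rewrite -natr1; lra.
Qed.

Lemma grad_norm_le f (L : R) : (grad_norm w f <= L%:E)%E <-> lipschitz L f.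
Proof.
split=> [fL x y /adjC yx|fL].
  rewrite -lee_fin; apply: le_trans fL; apply: ereal_sup_ubound.
  by exists (y, x) => //=; rewrite /nabla dist_adj ?divr1.
apply: ge_ereal_sup => _ [[x y] /= xy <-].
by rewrite lee_fin /nabla dist_adj // divr1 fL //; apply: adjC.
Qed.

(** Serves to check the norm condition on test functions in [kappa]. *)
Lemma grad_norm_eq1 f x y : lipschitz 1 f -> adj w x y -> f y - f x = 1 ->
  grad_norm w f = 1%E.
Proof.
move=> /grad_norm_le f1 /adjC yx fxy; apply/eqP; rewrite eq_le f1 /=.
apply: ereal_sup_ubound; exists (y, x) => //=.
by rewrite /nabla dist_adj // divr1 fxy.
Qed.

(** * Positive curvature: bounded diameter, finiteness, Lipschitz contraction *)

Section curvature.
Variable K : R.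
Hypothesis K0 : 0 < K.
Hypothesis kappaK : forall x y, x <> y -> (K%:E <= kappa w m x y)%E.

Lemma nabla_Lap_ge f x y : x <> y -> nabla w y x f = 1 -> grad_norm w f = 1%E ->
  K <= nabla w x y (Lap w m f).
Proof.
move=> xy fxy f1; rewrite -lee_fin; apply: le_trans (kappaK _ _ xy) _.
by apply: ereal_inf_lbound; exists f.
Qed.

(* Bonnet-Myers: test the curvature bound against [- dist y]. *)
Lemma dist_le x y : dist w x y <= 2 / K.
Proof.
have [<-|/eqP xy] := eqVneq x y; first by rewrite distxx divr_ge0 // ltW.
pose f z : R := - 1 * dist w y z.
have f1 : lipschitz 1 f.
  by move=> a b /adjC /dist_lipschitz => /(_ y); rewrite /f; lra.
(* The last edge of a walk from [x] to [y] is one on which [f] has slope 1. *)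
have [z zy] : exists z, adj w z y.
  have [n nP] := conn x y; clear f f1.
  by case: nP xy => [? /(_ erefl)//|? ? z ? _ zy _]; exists z.
have := nabla_Lap_ge f x y xy.
rewrite {1}/nabla {1 2}/f distxx mulr0 mulN1r opprK add0r.
rewrite divff; last by rewrite gt_eqF // dist_gt0 // => /esym.
move=> /(_ erefl); rewrite (grad_norm_eq1 f z y) //; last first.
  by rewrite /f distxx dist_adj; [lra|exact: adjC].
move=> /(_ erefl); rewrite /nabla ler_pdivlMr ?dist_gt0 // => Kd.
rewrite ler_pdivlMr // mulrC; apply: le_trans Kd _.
have := Lap_le f x 1 ler01 (fun z => f1 x z).
have := Lap_ge f y 1 ler01 (fun z yz => f1 z y (adjC _ _ yz)).
by lra.
Qed.

Lemma finite_walk n x : finite_set [set y | walk w n x y].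
Proof.
elim: n => [|n IH].
  apply: (sub_finite_set _ (finite_set1 x)) => y /= xy.
  by inversion xy.
apply: (@sub_finite_set _ _
  (\bigcup_(y in [set y | walk w n x y]) [set z | adj w y z])).
  by move=> z xz; inversion xz; subst; exists y.
exact: bigcup_finite.
Qed.

Lemma walk_bounded : exists N, forall x y, exists2 n, (n < N)%N & walk w n x y.
Proof.
(* The successor turns [n <= 2 / K] into the strict bound required by [I_N]. *)
exists (Num.truncn (2 / K)).+1 => x y; have [n [nP dE _]] := distP x y.
exists n => //; rewrite ltnS truncn_ge_nat; last by rewrite divr_ge0 // ltW.
by rewrite -dE dist_le.
Qed.

(** Each walk length reaches finitely many endpoints, and boundedly many lengths suffice. *)
Lemma finite_vertices : finite_set [set: V].
Proof.
have [->|/set0P[x _]] := eqVneq [set: V] set0; first exact: finite_set0.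
have [N NP] := walk_bounded.
apply: (@sub_finite_set _ _ (\bigcup_(n in `I_N) [set y | walk w n x y])).
  by move=> y _; have [n nN] := NP x y; exists n.
by apply: bigcup_finite => // n _; exact: finite_walk.
Qed.

(* If [f y - f x = 1 - d] on an edge, raising [f] to [max f (f y + d - dist y)]
   gives a competitor for [kappa x y] at uniform distance at most [d] from [f]. *)
Lemma Lap_contract (L eps : R) f : 0 < L -> 0 < eps <= 2^-1 ->
  lipschitz L f -> lipschitz (L * (1 - eps * K)) (fun x => f x + eps * Lap w m f x).
Proof.
(* By homogeneity, [f] is rescaled to Lipschitz constant 1. *)
move=> L0 /andP[e0 e2]; wlog : L f L0 / L = 1.
  move=> H fL; have := H 1 (fun x => L^-1 * f x) ltr01 erefl.
  have f1 : lipschitz 1 (fun x => L^-1 * f x).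
    by move=> x y /fL; rewrite -mulrBr mulrC ler_pdivrMr // mul1r.
  move=> /(_ f1) H1 x y /H1; rewrite !LapZ mul1r -(ler_pM2l L0).
  apply: le_trans; rewrite le_eqVlt; apply/orP; left; apply/eqP; field.
  by rewrite gt_eqF.
move=> -> f1 x y xy; have yx := adjC _ _ xy.
pose d := 1 - (f y - f x).
have d0 : 0 <= d by rewrite subr_ge0 f1.
pose F z := Num.max (f z) (f y + d - dist w y z).
(* This gives [F <= f + d]. *)
have fy z : f y - dist w y z <= f z.
  have [n [nP -> _]] := distP y z.
  pose mf z : R := - f z.
  have /lipschitz_walk/(_ nP) : lipschitz 1 mf.
    by move=> a b /adjC/f1; rewrite /mf; lra.
  by rewrite /mf; lra.
have Fx : F x = f x by rewrite /F dist_adj // /d; apply/max_idPl; lra.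
have Fy : F y = f y + d by rewrite /F distxx subr0; apply/max_idPr; lra.
have F1 : lipschitz 1 F.
  move=> a b ab; have := f1 a b ab; have := dist_lipschitz y _ _ (adjC _ _ ab).
  rewrite /F; case: (leP (f a)) => ?; case: (leP (f b)) => ?; lra.
have := nabla_Lap_ge F x y (adj_neq _ _ xy).
rewrite {1}/nabla dist_adj // divr1 {1}Fx {1}Fy /nabla dist_adj // divr1.
have -> : f y + d - f x = 1 by rewrite /d; lra.
move=> /(_ erefl); rewrite (grad_norm_eq1 F x y) //; last by rewrite Fx Fy /d; lra.
move=> /(_ erefl).
(* [h = F - f] has its minimum 0 at [x] and its maximum [d] at [y], so its Laplacian is at most [d]
   at [x] and at least [- d] at [y]. *)
pose h z := -1 * f z + F z.
have h_ge0 z : 0 <= h z by rewrite /h /F; case: (leP (f z)) => ?; lra.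
have h_led z : h z <= d by have := fy z; rewrite /h /F; case: (leP (f z)) => ?; lra.
have hx : h x = 0 by rewrite /h Fx; lra.
have hy : h y = d by rewrite /h Fy; lra.
have := Lap_le h x d d0; have := Lap_ge h y d d0.
rewrite /h !LapD !LapZ -/(h x) -/(h y) hx hy => H1 H2 H3.
have {}H1 : - d <= - 1 * Lap w m f y + Lap w m F y.
  by apply: H1 => z _; have := h_ge0 z; rewrite /h; lra.
have {}H2 : - 1 * Lap w m f x + Lap w m F x <= d.
  by apply: H2 => z _; have := h_led z; rewrite /h; lra.
(* Curvature gives [- K] for [F]; returning to [f] costs [d] at each endpoint. *)
have : eps * (Lap w m f y - Lap w m f x) <= eps * (2 * d - K).
  by rewrite ler_pM2l //; lra.
(* As [eps <= 1/2], the cost [2 * eps * d] is covered by the slack in [f y - f x = 1 - d]. *)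
have : eps * d <= 2^-1 * d by rewrite ler_wpM2r.
by rewrite /d; lra.
Qed.

(** * Summation by parts and one step of the exponential moment *)

Section finite_graph.
Variable s : seq V.
Hypothesis uniq_s : uniq s.
Hypothesis mem_s : forall x, x \in s.

Lemma fsum_adjE (F : V -> R) x : (forall y, w x y = 0 -> F y = 0) ->
  \sum_(y \in [set y | adj w x y]) F y = \sum_(y <- s) F y.
Proof.
move=> F0; apply: fsbig_fwiden => // [y _|y [_ /negP]]; first exact: mem_s.
by rewrite lt_neqAle w_ge0 andbT negbK => /eqP /esym /F0.
Qed.

Lemma sum_w_le x : \sum_(y <- s) w x y <= m x.
Proof.
have := Deg_le1 x; rewrite /Deg fsum_adjE => [|y]; last first.
  by rewrite /q => ->; rewrite mul0r.
by rewrite /q -mulr_suml ler_pdivrMr // mul1r.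
Qed.

Lemma mass_Lap f x : m x * Lap w m f x = \sum_(y <- s) w x y * (f y - f x).
Proof.
rewrite /Lap fsum_adjE => [|y]; last by rewrite /q => ->; rewrite !mul0r.
rewrite mulr_sumr; apply: eq_bigr => y _; rewrite /q; field.
by rewrite gt_eqF.
Qed.

Lemma sum_symmetrize (A : V -> V -> R) : \sum_(x <- s) \sum_(y <- s) A x y =
  \sum_(x <- s) \sum_(y <- s) (A x y + A y x) / 2.
Proof.
have AC : \sum_(x <- s) \sum_(y <- s) A y x = \sum_(x <- s) \sum_(y <- s) A x y.
  by rewrite exchange_big.
under [RHS]eq_bigr do rewrite -mulr_suml big_split /=.
by rewrite -mulr_suml big_split /= AC; lra.
Qed.

(** The terms [w x y * (f y - f x)] are antisymmetric and cancel in pairs. *)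
Lemma sum_mass_Lap f : \sum_(x <- s) m x * Lap w m f x = 0.
Proof.
under eq_bigr do rewrite mass_Lap.
rewrite sum_symmetrize big1 // => x _; rewrite big1 // => y _.
by rewrite (w_sym y x); lra.
Qed.

Lemma expR_Lap_ge (L : R) f : lipschitz L f ->
  - (L ^+ 2 / 2) * (\sum_(x <- s) m x * expR (f x)) <=
  \sum_(x <- s) m x * (expR (f x) * Lap w m f x).
Proof.
move=> fL; rewrite mulNr lerNl -sumrN.
have -> : \sum_(x <- s) - (m x * (expR (f x) * Lap w m f x)) =
    \sum_(x <- s) \sum_(y <- s) w x y * (expR (f x) * (f x - f y)).
  apply: eq_bigr => x _; rewrite mulrCA mass_Lap mulr_sumr -sumrN.
  by apply: eq_bigr => y _; lra.
apply: (@le_trans _ _ (L ^+ 2 / 2 *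
    \sum_(x <- s) (\sum_(y <- s) w x y) * expR (f x))); last first.
  rewrite ler_wpM2l ?divr_ge0 ?sqr_ge0 //; apply: ler_sum => x _.
  by rewrite ler_wpM2r ?expR_ge0 // sum_w_le.
(* Symmetrizing both double sums reduces the claim to a comparison for each pair. *)
under [in leRHS]eq_bigr do rewrite mulr_suml.
rewrite sum_symmetrize [in leRHS]sum_symmetrize mulr_sumr.
apply: ler_sum => x _; rewrite mulr_sumr; apply: ler_sum => y _.
rewrite (w_sym y x).
have [xy|] := ltP 0 (w x y); last first.
  move=> wxy; have -> : w x y = 0 by apply/eqP; rewrite eq_le wxy w_ge0.
  by rewrite !mul0r !(addr0, mul0r, mulr0).
have fxy : (f x - f y) ^+ 2 <= L ^+ 2.
  by have := fL _ _ xy; have := fL _ _ (adjC _ _ xy); nra.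
have := expR_secant_le _ (f x) (f y) => h1.
have := ler_wpM2l (addr_ge0 (expR_ge0 (f x)) (expR_ge0 (f y))) fxy => h2.
have {h1 h2} : (expR (f x) - expR (f y)) * (f x - f y) <=
  (expR (f x) + expR (f y)) / 2 * L ^+ 2 by lra.
by move=> /(ler_wpM2l (ltW xy)); lra.
Qed.

(* By convexity of [expR], the first-order variation of the exponential moment
   bounds its decrease with no second-order error term. *)
Lemma expR_moment_step (L eps : R) f : 0 <= eps -> lipschitz L f ->
  (1 - eps * L ^+ 2 / 2) * (\sum_(x <- s) m x * expR (f x)) <=
  \sum_(x <- s) m x * expR (f x + eps * Lap w m f x).
Proof.
move=> e0 /expR_Lap_ge /(ler_wpM2l e0) h.
have : \sum_(x <- s) m x * expR (f x) +
   eps * (\sum_(x <- s) m x * (expR (f x) * Lap w m f x)) <=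
   \sum_(x <- s) m x * expR (f x + eps * Lap w m f x).
  rewrite mulr_sumr -big_split /=; apply: ler_sum => x _.
  have := expR_ge1Dx (eps * Lap w m f x).
  move=> /(ler_wpM2l (mulr_ge0 (ltW (m_gt0 x)) (expR_ge0 (f x)))).
  by rewrite expRD; lra.
by lra.
Qed.

(** * Iteration and concentration for total mass 1 *)

Hypothesis mass1 : \sum_(x <- s) m x = 1.

Lemma expR_moment_gt0 f : 0 < \sum_(x <- s) m x * expR (f x).
Proof.
have : 0 <= \sum_(x <- s) m x * expR (f x).
  by apply: sumr_ge0 => x _; rewrite mulr_ge0 ?expR_ge0 // ltW.
rewrite le_eqVlt => /predU1P[/esym/eqP|//].
rewrite psumr_eq0 => [/allP all0|x _]; last by rewrite mulr_ge0 ?expR_ge0 // ltW.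
move: mass1; rewrite big_seq big1 => [/eqP|x /all0].
  by rewrite eq_sym oner_eq0.
by rewrite gt_eqF // mulr_gt0 ?expR_gt0.
Qed.

(** A value above [D * L] would force [f] to be positive everywhere, against mean zero. *)
Lemma mean0_le (D L : R) f : 0 <= D -> 0 <= L ->
  (forall x y, exists2 n, n%:R <= D & walk w n x y) ->
  lipschitz L f -> \sum_(x <- s) m x * f x = 0 -> forall x, f x <= D * L.
Proof.
move=> D0 L0 wD fL mf x; rewrite leNgt; apply/negP => fx.
have f_gt0 y : 0 < f y.
  have [n nD /(lipschitz_walk _ _ _ _ _ fL)] := wD y x.
  by have := ler_wpM2r L0 nD; lra.
move: mf => /eqP; rewrite psumr_eq0 => [/allP/(_ x (mem_s x))|y _]; last first.
  by rewrite ltW // mulr_gt0.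
by rewrite gt_eqF // mulr_gt0.
Qed.

(** Induction with [L] replaced by [L * rho], [rho = 1 - eps * K]. The drop in [c * L ^+ 2] pays for
    each step's loss: [c] exceeds [1 / (4 * K)], and the margin [2 * K * c - 1/2] absorbs the
    higher-order terms in [eps]. *)
Lemma expR_moment_iter (D c eps L0 : R) n L f : 0 <= D ->
  (forall x y, exists2 n, n%:R <= D & walk w n x y) ->
  0 < c -> 0 < eps <= 2^-1 -> eps * K < 1 ->
  eps * (c * K ^+ 2 + L0 ^+ 2 * c * K) <= 2 * K * c - 2^-1 ->
  0 < L <= L0 -> lipschitz L f -> \sum_(x <- s) m x * f x = 0 ->
  \sum_(x <- s) m x * expR (f x) <=
  expR (c * L ^+ 2 + D * L * (1 - eps * K) ^+ n).
Proof.
move=> D0 wD c0 eP eK ec; have /andP[e0 e2] := eP.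
elim: n L f => [|n IH] L f /andP[L_gt0 LL0] fL mf.
  rewrite expr0 mulr1 -[leRHS]mul1r -mass1 mulr_suml; apply: ler_sum => x _.
  rewrite ler_wpM2l ?ler_expR //; first exact: ltW.
  have := mean0_le D L f D0 (ltW L_gt0) wD fL mf x.
  have : 0 <= c * L ^+ 2 by rewrite mulr_ge0 ?sqr_ge0 // ltW.
  by lra.
set rho := 1 - eps * K.
have rho0 : 0 < rho by rewrite subr_gt0.
have eK0 : 0 < eps * K by rewrite mulr_gt0.
have rho1 : rho <= 1 by rewrite /rho; lra.
pose g x := f x + eps * Lap w m f x.
have mg : \sum_(x <- s) m x * g x = 0.
  rewrite /g; under eq_bigr do rewrite mulrDr mulrCA.
  by rewrite big_split /= mf add0r -mulr_sumr sum_mass_Lap mulr0.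
have gL : lipschitz (L * rho) g by exact: Lap_contract.
have /IH : 0 < L * rho <= L0.
  by rewrite mulr_gt0 //=; apply: le_trans LL0; rewrite ler_piMr // ltW.
move=> /(_ g gL mg); have := expR_moment_step L eps f (ltW e0) fL.
have := expR_moment_gt0 f; have := expR_moment_gt0 g.
rewrite -/g; set E := \sum_(x <- s) _; set E' := \sum_(x <- s) _.
move=> E0 E'0 EE' IHg.
set v := c * L ^+ 2 * (1 - rho ^+ 2).
have -> : c * L ^+ 2 + D * L * rho ^+ n.+1 =
    v + (c * (L * rho) ^+ 2 + D * (L * rho) * rho ^+ n).
  by rewrite /v (exprS rho n); ring.
rewrite expRD; apply: (@le_trans _ _ (expR v * E)); last first.
  by rewrite ler_wpM2l ?expR_ge0.
set u := eps * L ^+ 2 / 2 in EE'.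
have v0 : 0 <= v.
  apply: mulr_ge0; first by rewrite mulr_ge0 ?sqr_ge0 // ltW.
  by rewrite subr_ge0 exprn_ile1 // ltW.
(* Here [1 - u] is the one-step loss factor and [1 + v <= expR v] compensates it. *)
have uv : 1 <= (1 + v) * (1 - u).
  have vE : v = L ^+ 2 * eps * (c * (2 * K - eps * K ^+ 2)) by rewrite /v /rho; ring.
  have L2 : L ^+ 2 <= L0 ^+ 2 by nra.
  have cK : 0 <= c * K * eps by rewrite !mulr_ge0 // ltW.
  have h0 : 0 <= L ^+ 2 * eps by rewrite mulr_ge0 ?sqr_ge0 // ltW.
  have h1 := ler_wpM2l cK L2.
  have h2 : 0 <= L ^+ 2 * eps * (c * eps * K ^+ 2).
    by rewrite mulr_ge0 // !mulr_ge0 ?sqr_ge0 // ltW.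
  have h3 : 0 <= c * (2 * K - eps * K ^+ 2) - 2^-1 -
      L ^+ 2 / 2 * eps * (c * (2 * K - eps * K ^+ 2)).
    by lra.
  by have := mulr_ge0 h0 h3; rewrite vE /u; lra.
have h1 : (1 + v) * ((1 - u) * E') <= (1 + v) * E by rewrite ler_wpM2l //; lra.
have h2 : (1 + v) * E <= expR v * E by rewrite ler_pM2r // expR_ge1Dx.
have h3 : E' <= (1 + v) * (1 - u) * E' by rewrite ler_peMl // ltW.
by lra.
Qed.

Lemma expR_moment_le (L : R) f : 0 < L -> lipschitz L f ->
  \sum_(x <- s) m x * f x = 0 ->
  \sum_(x <- s) m x * expR (f x) <= expR (L ^+ 2 / (4 * K)).
Proof.
move=> L0 fL mf; have [N NP] := walk_bounded.
have wD x y : exists2 n, n%:R <= N%:R :> R & walk w n x y.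
  by have [n /ltnW nN] := NP x y; exists n => //; rewrite ler_nat.
set E := \sum_(x <- s) _; have E0 : 0 < E by exact: expR_moment_gt0.
rewrite -[E]lnK ?posrE // ler_expR; apply/ler_addgt0Pr => d d0.
(* Chosen so that [t * L ^+ 2 = d / 2]; the other half of [d] is left for the tail in [rho ^+ n]. *)
pose t := d / (2 * L ^+ 2); pose c := (4 * K)^-1 + t.
have L20 : 0 < L ^+ 2 by rewrite exprn_gt0.
have t0 : 0 < t by rewrite divr_gt0 // mulr_gt0.
have c0 : 0 < c by rewrite addr_gt0 // invr_gt0 mulr_gt0.
pose B := c * K ^+ 2 + L ^+ 2 * c * K.
have B0 : 0 < B by rewrite addr_gt0 ?mulr_gt0 // exprn_gt0.
(* The three bounds serve the contraction, [eps * K < 1], and the margin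
   [2 * K * c - 1/2 = 2 * K * t]. *)
pose eps := Num.min (2^-1) (Num.min (2 * K)^-1 (2 * K * t / B)).
have eps0 : 0 < eps.
  have Kt : 0 < 2 * K * t by apply: mulr_gt0 t0; rewrite mulr_gt0.
  by rewrite !lt_min !invr_gt0 ltr0n mulr_gt0 //= divr_gt0.
have eps2 : eps <= 2^-1 by rewrite ge_min lexx.
have epsK : eps * K < 1.
  have : eps <= (2 * K)^-1 by rewrite !ge_min lexx !orbT.
  rewrite -(ler_pM2r K0) => /le_lt_trans; apply.
  by rewrite invfM mulfVK ?gt_eqF //; lra.
have epsB : eps * B <= 2 * K * c - 2^-1.
  have -> : 2 * K * c - 2^-1 = 2 * K * t by rewrite /c; field; rewrite gt_eqF.
  by rewrite -ler_pdivlMr // !ge_min lexx !orbT.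
pose rho := 1 - eps * K.
have rho1 : `|rho| < 1.
  by have := mulr_gt0 eps0 K0; rewrite /rho ltr_norml; lra.
have [n nP] : exists n, N%:R * L * rho ^+ n <= d / 2.
  (* Adding 1 keeps the divisor positive whatever [N] is. *)
  have d2 : 0 < d / 2 / (N%:R * L + 1).
    by rewrite !divr_gt0 // ltr_wpDl // mulr_ge0 // ltW.
  have /cvgrPdist_lt/(_ _ d2)[n _ /(_ n (leqnn n))] := cvg_expr rho1.
  rewrite /= sub0r normrN ltr_pdivlMr ?ltr_wpDl ?mulr_ge0 ?(ltW L0) //.
  move=> h; exists n; apply: le_trans (ltW h).
  have := ler_norm (rho ^+ n); have := normr_ge0 (rho ^+ n).
  have : 0 <= N%:R * L by rewrite mulr_ge0 // ltW.
  by nra.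
have := expR_moment_iter N%:R c eps L n L f (ler0n _ _) wD c0.
rewrite eps0 eps2 L0 lexx => /(_ isT epsK epsB isT fL mf).
rewrite -/E -{1}(@lnK _ E) ?posrE // ler_expR -/rho => /le_trans; apply.
have -> : c * L ^+ 2 = L ^+ 2 / (4 * K) + d / 2.
  by rewrite /c /t; field; rewrite !gt_eqF.
by lra.
Qed.

(** The choice [l = 2 * K * r] minimises the exponent [- (l * r) + l ^+ 2 / (4 * K)]. *)
Lemma deviation_le f (r : R) : 0 < r -> lipschitz 1 f ->
  \sum_(x <- s) m x * f x = 0 ->
  \sum_(x <- s | r < f x) m x <= expR (- (K * r ^+ 2)).
Proof.
move=> r0 f1 mf; pose l := 2 * K * r; have l0 : 0 < l by rewrite !mulr_gt0.
have lf : lipschitz l (fun x => l * f x).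
  by move=> x y /f1 fxy; rewrite -mulrBr ler_piMr // ltW.
have := expR_moment_le l _ l0 lf.
have -> : \sum_(x <- s) m x * (l * f x) = 0.
  by under eq_bigr do rewrite mulrCA; rewrite -mulr_sumr mf mulr0.
move=> /(_ erefl) h.
have -> : - (K * r ^+ 2) = - (l * r) + l ^+ 2 / (4 * K).
  by rewrite /l; field; rewrite gt_eqF.
rewrite expRD; apply: le_trans (ler_wpM2l (expR_ge0 _) h).
rewrite mulr_sumr big_mkcond /=; apply: ler_sum => x _.
rewrite mulrCA -expRD; case: ifPn => [rf|_]; last first.
  by rewrite mulr_ge0 ?expR_ge0 // ltW.
rewrite ler_peMr ?(ltW (m_gt0 x)) // -expR0 ler_expR addrC subr_ge0.
by rewrite ler_pM2l // ltW.
Qed.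

End finite_graph.
End curvature.
End graph.

(** * From extended sums to finite sums, and conclusion *)

Theorem theorem3p1 (R : realType) (V : countType) (w : V -> V -> R) (m : V -> R)
  (K : R) :
  is_mwgraph w m -> locally_finite w -> graph_connected w ->
  0 < K ->
  (Deg_max w m <= 1)%E ->
  meas m setT = 1%E ->
  (forall x y : V, x <> y -> (K%:E <= kappa w m x y)%E) ->
  forall f : V -> R, ell1 m f -> mean m f = 0%E -> (grad_norm w f <= 1)%E ->
  forall r : R, 0 < r ->
    (meas m [set x | (r < f x)%R] <= (expR (- (K * r ^+ 2)))%:E)%E.
Proof.
move=> Gwm LFw conn K0 DegM mass1 kappaK f _ mf gf r r0.
have m_gt0 x : 0 < m x by case: Gwm.
have fin := finite_vertices _ _ _ _ Gwm LFw conn DegM K K0 kappaK.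
have [s0 /seteqP[s0P _]] := (finite_seqP _).1 fin.
pose s := undup s0; have uniq_s : uniq s by exact: undup_uniq.
have mem_s x : x \in s by rewrite mem_undup; exact: s0P.
have sE (A : set V) (F : V -> \bar R) : (forall x, 0 <= F x)%E ->
    (\esum_(x in A) F x = \sum_(x <- s | x \in A) F x)%E.
  move=> F0; rewrite esum_mkcond esum_fset; [|exact: fin|]; last first.
    by move=> x _; case: ifP.
  rewrite [RHS]big_mkcond [RHS]fsbig_seq //; have -> // : [set` s] = [set: V].
  by apply/seteqP; split=> x // _; exact: mem_s.
have sTE (F : V -> \bar R) : (forall x, 0 <= F x)%E ->
    (\esum_(x in [set: V]) F x = \sum_(x <- s) F x)%E.
  by move=> F0; rewrite sE //; apply: eq_bigl => x; rewrite in_setT.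
have m0 x : (0 <= (m x)%:E)%E by rewrite lee_fin ltW.
have {}mass1 : \sum_(x <- s) m x = 1.
  by apply: EFin_inj; rewrite -sumEFin -mass1 /meas sTE.
have {}mf : \sum_(x <- s) m x * f x = 0.
  (* On finite [V] the positive and negative parts have finite sums, which recombine termwise. *)
  apply: EFin_inj; apply: (etrans _ mf); rewrite /mean.
  rewrite (eq_esum (b := fun x => (Num.max (m x * f x) 0)%:E)); last first.
    by move=> x _; rewrite funeposE EFin_max.
  rewrite (eq_esum (a := _^\-%E)
    (b := fun x => (Num.max (- (m x * f x)) 0)%:E)); last first.
    by move=> x _; rewrite funenegE EFin_max EFinN.
  rewrite !sTE; try by move=> x; rewrite lee_fin le_max lexx orbT.
  rewrite !sumEFin -EFinB; congr EFin; rewrite -sumrB.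
  apply: eq_bigr => x _; case: (leP (m x * f x)) => ?;
    case: (leP (- (m x * f x))) => ?; lra.
rewrite /meas sE // sumEFin lee_fin.
rewrite (eq_bigl (fun x => r < f x)); last first.
  by move=> x; apply/idP/idP; rewrite in_setE.
apply: (deviation_le _ _ _ _ Gwm LFw conn DegM K K0 kappaK s uniq_s mem_s) => //.
exact/(grad_norm_le _ _ _ _ Gwm conn).
Qed.
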